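(* Let $K$ be a field, let $P$ be a finite locally distributive lattice and let $T$ be the $KP$-algebra with $T_z=K[[0_P,z]]/(x\cdot y-(x\wedge y)\cdot(x\vee y) : x,y\in[0_P,z])$ for $z\in P$. Then $\lim_P T$ is a $\mathbb Z$-graded ASL on $P^{\mathrm{op}}$ over $K$, and $\lim_P T= K[P]/I_T$, where the ideal $I_T$ is generated by the elements $$xy-(x\wedge y)\sum_{z} z,\qquad x,y\in P,$$ where $z$ ranges over all minimal upper bounds for $x,y$ in $P$, and the sum is defined to be zero if there are no such elements.
   Context: A finite poset $P$ is a locally distributive lattice if it has a unique minimal element $0_P$ (terminal element, $0_P\le z$ for all $z$) and for every $z\in P$ the interval $[0_P,z]$ is a distributive lattice. For a subset $Q\subseteq P$, $K[Q]$ is the polynomial ring on the elements of $Q$ as variables. In the definition of $T_z$, $\wedge$ and $\vee$ denote meet and join in the distributive lattice $[0_P,z]$. For $z'\le z$ the homomorphism $T_{z'z}\colon T_z\to T_{z'}$ is the restriction homomorphism, sending the class of a variable $x$ to the class of $x$ if $x\le z'$ and to $0$ otherwise. All variables have degree $1$, so $T$ is $\mathbb Z$-graded. If $x,y$ have a common upper bound $z$, their meet in $[0_P,z]$ is their meet $x\wedge y$ in $P$; if $x,y$ have no upper bound, the generator is just $xy$. A $KP$-algebra is a system of $K$-algebras $(T_x)_{x\in P}$ with $K$-algebra homomorphisms $T_{xy}\colon T_y\to T_x$ for $x\le y$ satisfying $T_{xx}=\mathrm{id}$, $T_{xy}T_{yz}=T_{xz}$; its limit is $\lim_P T=\{(s_x)\in\prod_x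 T_x: T_{xy}(s_y)=s_x\ \forall x\le y\}$. The identification $\lim_P T=K[P]/I_T$ is via the natural map $K[P]\to\lim_P T$ whose component at $z$ sends a variable $x$ to its class in $T_z$ if $x\le z$ and to $0$ otherwise. ASL: a monomial $m\in\mathbb N^P$ is standard if its support $\{x:m(x)\neq0\}$ is a chain in $P$. A $K$-algebra $A$ with an injection $\phi\colon P\to A$, $\phi(m)=\prod_x\phi(x)^{m(x)}$, is an ASL on $P^{\mathrm{op}}$ over $K$ if (ASL1) the standard monomials $\phi(m)$ form a $K$-basis of $A$; (ASL2) if $x,y\in P$ are incomparable and $\phi(x)\phi(y)=\sum_m r_m\phi(m)$ is the unique representation by standard monomials, then $r_m\neq0$ implies that the maximal element $x_m$ of the support of $m$ satisfies $x<x_m$ and $y<x_m$. It is a graded ASL if $A$ is a graded $K$-algebra and all (images of) elements of $P$ are homogeneous of positive degree. *)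

(* Defs.v *)
From HB Require Import structures.
From mathcomp Require Import all_boot all_order all_algebra.
From mathcomp Require Import ring_quotient.
From mathcomp Require Import finmap mpoly boolp.

Set Implicit Arguments.
Unset Strict Implicit.
Unset Printing Implicit Defensive.

Import Order.TTheory GRing.Theory.
Local Open Scope ring_scope.

Section Posets.
Variables (d : Order.disp_t) (Q : porderType d).
Implicit Types x y m j : Q.

Definition is_glb x y m : Prop :=
  [/\ (m <= x)%O, (m <= y)%O
    & forall w, (w <= x)%O -> (w <= y)%O -> (w <= m)%O].

Definition is_lub x y j : Prop :=
  [/\ (x <= j)%O, (y <= j)%O
    & forall w, (x <= w)%O -> (y <= w)%O -> (j <= w)%O].

Definition is_distributive_lattice : Prop :=
  exists (d' : Order.disp_t) (L : distrLatticeType d') (f : Q -> L),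
    bijective f /\ {mono f : x y / (x <= y)%O}.

End Posets.

Section Intervals.
Variables (d : Order.disp_t) (P : finBPOrderType d).

(* [0_P, z]; the lower bound 0_P = \bot is automatic. *)
Definition lower_interval (z : P) := {x : P | (x <= z)%O}.

HB.instance Definition _ (z : P) := Finite.on (lower_interval z).
HB.instance Definition _ (z : P) := SubType.on (lower_interval z).
HB.instance Definition _ (z : P) :=
  [SubChoice_isSubPOrder of lower_interval z by <: with d].

Definition locally_distributive : Prop :=
  forall z : P, is_distributive_lattice (lower_interval z).

Definition upper_bound (x y z : P) : bool := (x <= z)%O && (y <= z)%O.

Definition min_upper_bounds (x y : P) : {set P} :=
  [set z | upper_bound x y z
         & [forall w, upper_bound x y w && (w <= z)%O ==> (w == z)]].

End Intervals.

Definition ideal_gen (R : comNzRingType) (S : R -> Prop) : {pred R} :=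
  fun p => `[< exists s : seq (R * R),
    (forall q, q \in s -> S q.2) /\ p = \sum_(q <- s) q.1 * q.2 >].

(* Rings of the library are nontrivial, so that only proper ideals have a
   quotient. *)
Record proper_gens (R : comNzRingType) := ProperGens {
  gens :> R -> Prop;
  gens_proper : 1 \notin ideal_gen gens
}.

Section GeneratedIdeal.
Variable R : comNzRingType.
Implicit Type S : R -> Prop.

Lemma ideal_genP S p :
  reflect (exists s : seq (R * R),
    (forall q, q \in s -> S q.2) /\ p = \sum_(q <- s) q.1 * q.2)
    (p \in ideal_gen S).
Proof. exact: asboolP. Qed.

Lemma ideal_gen_incl S p : S p -> p \in ideal_gen S.
Proof.
move=> Sp; apply/ideal_genP; exists [:: (1, p)]; split.
  by move=> q; rewrite inE => /eqP ->.
by rewrite big_seq1 mul1r.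
Qed.

Lemma ideal_gen_lin S a : {in ideal_gen S &, forall u v, a * u + v \in ideal_gen S}.
Proof.
move=> _ _ /ideal_genP[s [hs ->]] /ideal_genP[t [ht ->]].
apply/ideal_genP; exists ([seq (a * q.1, q.2) | q <- s] ++ t); split.
  move=> q; rewrite mem_cat => /orP[]; last exact: ht.
  by case/mapP=> q' q's ->; apply: (hs q').
rewrite big_cat big_map mulr_sumr; congr (_ + _).
by apply: eq_bigr => q _; rewrite mulrA.
Qed.

Lemma ideal_gen0 S : 0 \in ideal_gen S.
Proof. by apply/ideal_genP; exists [::]; rewrite big_nil. Qed.

Lemma ideal_gen_ker S (A : comNzRingType) (f : {rmorphism R -> A}) p :
  (forall g, S g -> f g = 0) -> p \in ideal_gen S -> f p = 0.
Proof.
move=> fS /ideal_genP[s [hs ->]]; rewrite rmorph_sum big_seq big1 //= => q /hs Sq.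
by rewrite rmorphM /= (fS _ Sq) mulr0.
Qed.

Definition gen_ideal (S : proper_gens R) : {pred R} := ideal_gen S.

Lemma gen_ideal_idealr (S : proper_gens R) : idealr_closed (gen_ideal S).
Proof. by split; [exact: ideal_gen0|exact: gens_proper|exact: ideal_gen_lin]. Qed.

HB.instance Definition _ (S : proper_gens R) :=
  isIdealr.Build R (gen_ideal S) (gen_ideal_idealr S).

End GeneratedIdeal.

Section QuotientAlgebra.
Variables (K : fieldType) (R : comAlgType K) (S : proper_gens R).
Local Open Scope quotient_scope.

Definition quotalg := {ideal_quot (gen_ideal S)}.

HB.instance Definition _ := GRing.ComNzRing.on quotalg.

Definition quot_pi (p : R) : quotalg := \pi_{ideal_quot (gen_ideal S)} p.

Lemma quot_pi_zmod : zmod_morphism quot_pi.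
Proof. exact: (@pi_is_zmod_morphism _ _ _ {ideal_quot (gen_ideal S)}). Qed.
Lemma quot_pi_monoid : monoid_morphism quot_pi.
Proof. exact: (@pi_is_monoid_morphism _ _ _ {ideal_quot (gen_ideal S)}). Qed.
HB.instance Definition _ := GRing.isZmodMorphism.Build R quotalg quot_pi quot_pi_zmod.
HB.instance Definition _ := GRing.isMonoidMorphism.Build R quotalg quot_pi quot_pi_monoid.

Definition quot_repr (t : quotalg) : R := repr t.

Lemma quot_reprK : cancel quot_repr quot_pi.
Proof. by move=> t; apply: (@reprK _ {ideal_quot (gen_ideal S)}). Qed.

Lemma quot_piP p q : reflect (quot_pi p = quot_pi q) (p - q \in gen_ideal S).
Proof.
rewrite (@Quotient.idealrBE R (gen_ideal S)).
exact: (@eqP {ideal_quot (gen_ideal S)}).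
Qed.

Lemma quot_repr_pi p : quot_repr (quot_pi p) - p \in gen_ideal S.
Proof. by apply/quot_piP; rewrite quot_reprK. Qed.

Lemma gen_idealZ (a : K) p : p \in gen_ideal S -> a *: p \in gen_ideal S.
Proof. by move=> ip; rewrite -[p]mul1r scalerAl idealMr. Qed.

Definition quot_scale (a : K) (t : quotalg) : quotalg := quot_pi (a *: quot_repr t).

Lemma quot_scale_pi a p : quot_scale a (quot_pi p) = quot_pi (a *: p).
Proof. by apply/quot_piP; rewrite -scalerBr gen_idealZ ?quot_repr_pi. Qed.

Lemma quot_scaleA a b t : quot_scale a (quot_scale b t) = quot_scale (a * b) t.
Proof. by rewrite -[t]quot_reprK !quot_scale_pi scalerA. Qed.
Lemma quot_scale1 : left_id 1 quot_scale.
Proof. by move=> t; rewrite -[t]quot_reprK !quot_scale_pi scale1r. Qed.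
Lemma quot_scaleDr : right_distributive quot_scale +%R.
Proof.
move=> a t u; rewrite -[t]quot_reprK -[u]quot_reprK -rmorphD.
by rewrite !quot_scale_pi scalerDr rmorphD.
Qed.
Lemma quot_scaleDl t : {morph quot_scale^~ t : a b / a + b}.
Proof.
by move=> a b; rewrite -[t]quot_reprK !quot_scale_pi scalerDl rmorphD.
Qed.
HB.instance Definition _ := GRing.Zmodule_isLmodule.Build K quotalg
  quot_scaleA quot_scale1 quot_scaleDr quot_scaleDl.

Lemma quot_piZ : scalable quot_pi.
Proof. by move=> a p; rewrite -quot_scale_pi. Qed.
HB.instance Definition _ := GRing.isScalable.Build K R quotalg *:%R quot_pi quot_piZ.

Lemma quot_scaleAl a (t u : quotalg) : a *: (t * u) = a *: t * u.
Proof.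
rewrite -[t]quot_reprK -[u]quot_reprK.
by rewrite -rmorphM -!linearZ -rmorphM /= scalerAl.
Qed.
HB.instance Definition _ := GRing.Lmodule_isLalgebra.Build K quotalg quot_scaleAl.
HB.instance Definition _ := GRing.Lalgebra_isComAlgebra.Build K quotalg.

Section Lift.
Variables (A : comAlgType K) (f : {lrmorphism R -> A}).
Hypothesis fS : forall g, S g -> f g = 0.

(* Well-defined on classes by quot_liftE; the hypothesis is an argument so
   that the morphism instances below apply without side conditions. *)
Definition quot_lift of (forall g, S g -> f g = 0) : quotalg -> A :=
  fun t => f (quot_repr t).

Lemma quot_liftE p : quot_lift fS (quot_pi p) = f p.
Proof.
apply/eqP; rewrite -subr_eq0 /quot_lift -rmorphB /=; apply/eqP.
by apply: (ideal_gen_ker fS); apply: quot_repr_pi.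
Qed.

Lemma quot_lift_zmod : zmod_morphism (quot_lift fS).
Proof.
move=> t u; rewrite -[t]quot_reprK -[u]quot_reprK -rmorphB /= !quot_liftE.
by rewrite rmorphB.
Qed.
Lemma quot_lift_monoid : monoid_morphism (quot_lift fS).
Proof.
split=> [|t u]; first by rewrite -[1](rmorph1 quot_pi) quot_liftE rmorph1.
rewrite -[t]quot_reprK -[u]quot_reprK -rmorphM /= !quot_liftE.
by rewrite rmorphM.
Qed.
Lemma quot_lift_scalable : scalable (quot_lift fS).
Proof.
move=> a t; rewrite -[t]quot_reprK -linearZ /= !quot_liftE.
by rewrite linearZ.
Qed.
HB.instance Definition _ :=
  GRing.isZmodMorphism.Build quotalg A (quot_lift fS) quot_lift_zmod.
HB.instance Definition _ :=
  GRing.isMonoidMorphism.Build quotalg A (quot_lift fS) quot_lift_monoid.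
HB.instance Definition _ :=
  GRing.isScalable.Build K quotalg A *:%R (quot_lift fS) quot_lift_scalable.

End Lift.
End QuotientAlgebra.

(* K[Q]; the variable x has index enum_rank x. *)
Notation polyring K Q := {mpoly K[#|{: Q}|]}.

Section PolyRing.
Variables (K : fieldType) (Q : finType).

Definition var (x : Q) : polyring K Q := 'X_(enum_rank x).

Definition homogeneous (i : int) (p : polyring K Q) : Prop :=
  forall m, m \in msupp p -> Posz (mdeg m) = i.

Variable A : comAlgType K.

(* K[Q] -> A, x |-> h x *)
Definition poly_eval (h : Q -> A) : polyring K Q -> A :=
  mmap (in_alg A) (fun i => h (enum_val i)).

Lemma poly_eval_var h x : poly_eval h (var x) = h x.
Proof. by rewrite /poly_eval /var mmapX mmap1U enum_rankK. Qed.

Lemma poly_eval_scalable h : scalable (poly_eval h).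
Proof. by move=> a p; rewrite /poly_eval mmapZ /= mulr_algl. Qed.

HB.instance Definition _ h := GRing.RMorphism.on (poly_eval h).
HB.instance Definition _ h :=
  GRing.isScalable.Build K (polyring K Q) A *:%R (poly_eval h)
    (poly_eval_scalable h).

End PolyRing.

Lemma proper_at0 (K : fieldType) (Q : finType) (S : polyring K Q -> Prop) :
  (forall g, S g -> poly_eval (fun _ : Q => 0 : K^o) g = 0) ->
  1 \notin ideal_gen S.
Proof.
move=> S0; apply/negP => /(ideal_gen_ker S0)/eqP.
by rewrite rmorph1 oner_eq0.
Qed.

Record KPalgebra (K : fieldType) (d : Order.disp_t) (P : finBPOrderType d) :=
  KPAlgebra {
    alg_at :> P -> comAlgType K;
    (* T_{xy} *)
    res : forall x y : P, (x <= y)%O -> {lrmorphism alg_at y -> alg_at x};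
    res_id : forall (x : P) (h : (x <= x)%O), res h =1 id;
    res_comp : forall (x y z : P) (hxy : (x <= y)%O) (hyz : (y <= z)%O)
                      (hxz : (x <= z)%O), res hxy \o res hyz =1 res hxz
  }.

Section Product.
Variables (K : fieldType) (d : Order.disp_t) (P : finBPOrderType d).
Variable T : P -> comAlgType K.

Definition prodalg : Type := forall x, T x.
HB.instance Definition _ := Choice.copy prodalg (forall x, T x).

Implicit Types s t u : prodalg.

Lemma prodalgP s t : (forall x, s x = t x) -> s = t.
Proof. exact: functional_extensionality_dep. Qed.

Definition prod_zero : prodalg := fun=> 0.
Definition prod_opp s : prodalg := fun x => - s x.
Definition prod_add s t : prodalg := fun x => s x + t x.
Definition prod_one : prodalg := fun=> 1.
Definition prod_mul s t : prodalg := fun x => s x * t x.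
Definition prod_scale (a : K) s : prodalg := fun x => a *: s x.

Lemma prod_addA : associative prod_add.
Proof. by move=> s t u; apply: prodalgP => x; apply: addrA. Qed.
Lemma prod_addC : commutative prod_add.
Proof. by move=> s t; apply: prodalgP => x; apply: addrC. Qed.
Lemma prod_add0 : left_id prod_zero prod_add.
Proof. by move=> s; apply: prodalgP => x; apply: add0r. Qed.
Lemma prod_addN : left_inverse prod_zero prod_opp prod_add.
Proof. by move=> s; apply: prodalgP => x; apply: addNr. Qed.
HB.instance Definition _ :=
  GRing.isZmodule.Build prodalg prod_addA prod_addC prod_add0 prod_addN.

Lemma prod_mulA : associative prod_mul.
Proof. by move=> s t u; apply: prodalgP => x; apply: mulrA. Qed.
Lemma prod_mulC : commutative prod_mul.
Proof. by move=> s t; apply: prodalgP => x; apply: mulrC. Qed.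
Lemma prod_mul1 : left_id prod_one prod_mul.
Proof. by move=> s; apply: prodalgP => x; apply: mul1r. Qed.
Lemma prod_mulDl : left_distributive prod_mul prod_add.
Proof. by move=> s t u; apply: prodalgP => x; apply: mulrDl. Qed.
Lemma prod_1neq0 : prod_one != prod_zero.
Proof.
apply/eqP => /(congr1 (fun s : prodalg => s \bot%O))/eqP.
by rewrite /prod_one /prod_zero oner_eq0.
Qed.
HB.instance Definition _ := GRing.Zmodule_isComNzRing.Build prodalg
  prod_mulA prod_mulC prod_mul1 prod_mulDl prod_1neq0.

Lemma prod_scaleA a b s : prod_scale a (prod_scale b s) = prod_scale (a * b) s.
Proof. by apply: prodalgP => x; apply: scalerA. Qed.
Lemma prod_scale1 : left_id 1 prod_scale.
Proof. by move=> s; apply: prodalgP => x; apply: scale1r. Qed.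
Lemma prod_scaleDr : right_distributive prod_scale +%R.
Proof. by move=> a s t; apply: prodalgP => x; apply: scalerDr. Qed.
Lemma prod_scaleDl s : {morph prod_scale^~ s : a b / a + b}.
Proof. by move=> a b; apply: prodalgP => x; apply: scalerDl. Qed.
HB.instance Definition _ := GRing.Zmodule_isLmodule.Build K prodalg
  prod_scaleA prod_scale1 prod_scaleDr prod_scaleDl.

Lemma prod_scaleAl a s t : a *: (s * t) = a *: s * t.
Proof. by apply: prodalgP => x; apply: scalerAl. Qed.
HB.instance Definition _ := GRing.Lmodule_isLalgebra.Build K prodalg prod_scaleAl.
HB.instance Definition _ := GRing.Lalgebra_isComAlgebra.Build K prodalg.

End Product.

Section Limit.
Variables (K : fieldType) (d : Order.disp_t) (P : finBPOrderType d).
Variable T : KPalgebra K P.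

Definition compatible : {pred prodalg T} :=
  fun s => `[< forall (x y : P) (h : (x <= y)%O), res T h (s y) = s x >].

Lemma compatible_subalg : subalg_closed compatible.
Proof.
split.
- by apply/asboolP => x y h; rewrite rmorph1.
- move=> a s t /asboolP hs /asboolP ht; apply/asboolP => x y h.
  by rewrite -[LHS]/(res T h (a *: s y + t y)) linearD linearZ /= hs ht.
- move=> s t /asboolP hs /asboolP ht; apply/asboolP => x y h.
  by rewrite -[LHS]/(res T h (s y * t y)) rmorphM /= hs ht.
Qed.
HB.instance Definition _ :=
  GRing.isSubalgClosed.Build K (prodalg T) compatible compatible_subalg.

Record lim := Lim { lim_val :> prodalg T; _ : lim_val \in compatible }.

HB.instance Definition _ := [isSub for lim_val].
HB.instance Definition _ := [Choice of lim by <:].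
HB.instance Definition _ := [SubChoice_isSubComNzRing of lim by <:].
HB.instance Definition _ := [SubZmodule_isSubLmodule of lim by <:].
HB.instance Definition _ := [SubNzRing_SubLmodule_isSubLalgebra of lim by <:].
HB.instance Definition _ := [SubLalgebra_isSubAlgebra of lim by <:].

End Limit.

Arguments compatible {K d P} T.

Section ASL.
Variables (K : fieldType) (A : comAlgType K).

Record is_Zgrading (gr : int -> A -> Prop) : Prop := {
  Zgr0 : forall i, gr i 0;
  ZgrD : forall i a b, gr i a -> gr i b -> gr i (a + b);
  ZgrZ : forall i (k : K) a, gr i a -> gr i (k *: a);
  Zgr1 : gr 0 1;
  ZgrM : forall i j a b, gr i a -> gr j b -> gr (i + j) (a * b);
  Zgr_decomp : forall a, exists! c : {fsfun int -> A with 0},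
    (forall i, gr i (c i)) /\ a = \sum_(i <- finsupp c) c i
}.

Variables (d : Order.disp_t) (P : finPOrderType d).

Definition standard (m : {ffun P -> nat}) : bool :=
  [forall x, forall y, (m x != 0%N) && (m y != 0%N) ==> (x >=< y)%O].

Variable phi : P -> A.

Definition phi_mon (m : {ffun P -> nat}) : A := \prod_x phi x ^+ m x.

Definition mon_comb (r : {fsfun {ffun P -> nat} -> K with 0}) : A :=
  \sum_(m <- finsupp r) r m *: phi_mon m.

Definition standard_comb (r : {fsfun {ffun P -> nat} -> K with 0}) : Prop :=
  forall m, r m != 0 -> standard m.

Definition ASL1 : Prop :=
  (forall r, standard_comb r -> mon_comb r = 0 -> forall m, r m = 0) /\
  (forall a, exists2 r, standard_comb r & a = mon_comb r).

(* xm is the maximal element of the support of m. *)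
Definition ASL2 : Prop :=
  forall x y : P, ~~ (x >=< y)%O ->
  forall r, standard_comb r -> phi x * phi y = mon_comb r ->
  forall m, r m != 0 -> exists xm : P,
    [/\ m xm != 0%N, forall w, m w != 0%N -> (w <= xm)%O,
        (x < xm)%O & (y < xm)%O].

(* The order in ASL2 is that of P, so this is an ASL on P^op. *)
Definition is_ASL_op : Prop := [/\ injective phi, ASL1 & ASL2].

Definition is_graded_ASL_op (gr : int -> A -> Prop) : Prop :=
  [/\ is_Zgrading gr, is_ASL_op
    & forall x : P, exists2 i : int, 0 < i & gr i (phi x)].

End ASL.

Section Main.
Variables (K : fieldType) (d : Order.disp_t) (P : finBPOrderType d).

Definition T_gens (z : P) (g : polyring K (lower_interval z)) : Prop :=
  exists x y m j : lower_interval z,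
    [/\ is_glb x y m, is_lub x y j & g = var K x * var K y - var K m * var K j].

Lemma T_gens_proper z : 1 \notin ideal_gen (@T_gens z).
Proof.
apply: proper_at0 => _ [x [y [m [j [_ _ ->]]]]].
by rewrite rmorphB !rmorphM /= !poly_eval_var !mulr0 subr0.
Qed.

Definition T_ideal z := ProperGens (T_gens_proper z).

Definition T_at (z : P) : comAlgType K := quotalg (T_ideal z).

Definition T_class (z x : P) : T_at z :=
  if insub x is Some x' then quot_pi (T_ideal z) (var K (x' : lower_interval z)) else 0.

Lemma T_class_in z (x : lower_interval z) : T_class z (val x) = quot_pi (T_ideal z) (var K x).
Proof. by rewrite /T_class valK. Qed.

Lemma T_class_out z x : ~~ (x <= z)%O -> T_class z x = 0.
Proof. by move=> xz; rewrite /T_class insubN. Qed.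

Definition T_restr_poly z' z : polyring K (lower_interval z) -> T_at z' :=
  poly_eval (fun x : lower_interval z => T_class z' (val x)).
HB.instance Definition _ z' z := GRing.LRMorphism.on (@T_restr_poly z' z).

Lemma T_restr_gens z' z : (z' <= z)%O ->
  forall g, T_ideal z g -> T_restr_poly z' g = 0.
Proof.
move=> z'z _ [x [y [m [j [[mx my mM] [xj yj jM] ->]]]]].
rewrite /T_restr_poly rmorphB !rmorphM /= !poly_eval_var.
have jE : ((val j <= z') = (val x <= z') && (val y <= z'))%O.
  apply/idP/andP => [jz'|[xz' yz']].
    by split; apply: le_trans jz'.
  exact: (jM (exist _ z' z'z : lower_interval z)).
have [/andP[xz' yz']|nxy] := boolP ((val x <= z') && (val y <= z'))%O; last first.
  rewrite (T_class_out (x := val j)) ?jE // mulr0 subr0.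
  by move: nxy; rewrite negb_and => /orP[] /T_class_out ->; rewrite ?mul0r ?mulr0.
have jz' : (val j <= z')%O by rewrite jE xz'.
have mz' : (val m <= z')%O by apply: le_trans xz'.
pose x' : lower_interval z' := exist _ (val x) xz'.
pose y' : lower_interval z' := exist _ (val y) yz'.
pose m' : lower_interval z' := exist _ (val m) mz'.
pose j' : lower_interval z' := exist _ (val j) jz'.
rewrite -[val x]/(val x') -[val y]/(val y') -[val m]/(val m') -[val j]/(val j').
rewrite !T_class_in -!rmorphM -rmorphB /= -(rmorph0 (quot_pi (T_ideal z'))).
apply/quot_piP; rewrite subr0; apply: ideal_gen_incl.
exists x', y', m', j'; split => //; split => // w.
- by move=> wx wy; apply: (mM (exist _ (val w) (le_trans (valP w) z'z) : lower_interval z)).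
- by move=> xw yw; apply: (jM (exist _ (val w) (le_trans (valP w) z'z) : lower_interval z)).
Qed.

(* T_{z'z} : T_z -> T_{z'} *)
Definition T_restr z' z (h : (z' <= z)%O) : {lrmorphism T_at z -> T_at z'} :=
  quot_lift (T_restr_gens h).

Lemma T_restr_class z' z (h : (z' <= z)%O) x :
  T_restr h (T_class z x) = T_class z' x.
Proof.
have [xz|xz] := boolP (x <= z)%O; last first.
  rewrite T_class_out // rmorph0 T_class_out //.
  by apply: contra xz => /le_trans; apply.
rewrite -[x]/(val (exist _ x xz : lower_interval z)) T_class_in.
rewrite -[LHS]/(quot_lift (T_restr_gens h) _) quot_liftE.
exact: poly_eval_var.
Qed.

Lemma T_hom_ext z (A : comAlgType K) (f g : {lrmorphism T_at z -> A}) :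
  (forall x, f (T_class z x) = g (T_class z x)) -> f =1 g.
Proof.
move=> fg t; rewrite -[t]quot_reprK [quot_repr t]mpolyE !linear_sum /=.
apply: eq_bigr => m _; rewrite !linearZ /=; congr (_ *: _).
rewrite mpolyXE_id !rmorph_prod; apply: eq_bigr => i _; rewrite !rmorphXn /=.
by congr (_ ^+ _); move: (fg (val (enum_val i))); rewrite T_class_in /var enum_valK.
Qed.

Lemma T_restr_id z (h : (z <= z)%O) : T_restr h =1 id.
Proof.
by apply: (@T_hom_ext z (T_at z) (T_restr h) idfun) => x; apply: T_restr_class.
Qed.

Lemma T_restr_comp x y z (hxy : (x <= y)%O) (hyz : (y <= z)%O) (hxz : (x <= z)%O) :
  T_restr hxy \o T_restr hyz =1 T_restr hxz.
Proof.
apply: (@T_hom_ext z (T_at x) (T_restr hxy \o T_restr hyz) (T_restr hxz)) => v.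
by rewrite -[LHS]/(T_restr hxy (T_restr hyz (T_class z v))) !T_restr_class.
Qed.

Definition T_alg : KPalgebra K P := KPAlgebra T_restr_id T_restr_comp.

Lemma T_elt_compatible x : (fun z => T_class z x) \in compatible T_alg.
Proof. by apply/asboolP => z' z h; apply: T_restr_class. Qed.

Definition T_elt (x : P) : lim T_alg := Lim (T_elt_compatible x).

(* K[P] -> lim T; T_elt x has component T_class z x at z. *)
Definition T_nat : polyring K P -> lim T_alg := poly_eval T_elt.

(* Degree i part of T_z: classes of homogeneous polynomials of degree i. *)
Definition T_gr (z : P) (i : int) (t : T_at z) : Prop :=
  exists2 p, homogeneous i p & t = quot_pi (T_ideal z) p.

Definition lim_gr (i : int) (s : lim T_alg) : Prop :=
  forall z, T_gr i (lim_val s z).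

(* x and y may fail to have a meet in P when they have no upper bound; the
   sum is then zero and the generator is x y. *)
Definition IT_gens (g : polyring K P) : Prop :=
  exists x y : P,
    (exists2 m, is_glb x y m &
       (exists z, upper_bound x y z) /\
       g = var K x * var K y - var K m * \sum_(z in min_upper_bounds x y) var K z)
    \/ ((forall z, ~~ upper_bound x y z) /\ g = var K x * var K y).

Lemma IT_gens_proper : 1 \notin ideal_gen IT_gens.
Proof.
apply: proper_at0 => _ [x [y [[m _ [_ ->]]|[_ ->]]]];
  rewrite ?rmorphB !rmorphM /= !poly_eval_var.
  by rewrite !mul0r subr0.
by rewrite mulr0.
Qed.

Definition IT := ProperGens IT_gens_proper.

End Main.

(* Main.v *)
Require Import Defs.
From HB Require Import structures.
From mathcomp Require Import all_boot all_order all_algebra.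
From mathcomp Require Import ring_quotient.
From mathcomp Require Import finmap mpoly boolp.

Set Implicit Arguments.
Unset Strict Implicit.
Unset Printing Implicit Defensive.

Import Order.TTheory GRing.Theory.
Local Open Scope ring_scope.

(** The proof compares K[P]/I_T and lim T through standard monomials.

They span every algebra generated by elements that satisfy the relations of I_T
([phi_mon_straighten]): a product x y of incomparable elements is rewritten as
the sum of the (x /\ y) z over the minimal upper bounds z, and each step
strictly increases the weighted degree in which x counts 2 ^ |{y | y <= x}|,
because z lies strictly above both x and y. The degree is unchanged, so this
weight is bounded and the rewriting ends. This applies to K[P]/I_T, and also to
each T_z, since exactly one minimal upper bound of x, y <= z lies below z,
namely their join in [0,z].

They are independent because of Hibi's embedding. In T_z send x to the product
of the variables j over the join primes j <= x of [0,z]; the minimum counts as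
a join prime and records the degree. The relations of T_z hold since, for a join
prime j, j <= x \/ y means j <= x or j <= y. The image of a monomial m is the
monomial whose exponent at j is the sum of the m(x), x >= j; when the support of
m is a chain these sums determine m ([total_prime_exp_inj]), because join primes
separate the elements of a distributive lattice. So distinct standard monomials
have distinct monomials as images ([prime_embedding_coeff]), and the map T_z ->
K[[0,z]] is injective.

A vanishing combination of standard monomials in lim T is seen to be trivial by
projecting, for each m, to T_t with t the top of the support of m. Conversely, for
a compatible family (s_z) the coefficient of m in s_z is the same for all z >= t,
so the coefficients read at T_t assemble into one element ([lim_span]). Hence
standard monomials form a basis of lim T, and K[P]/I_T -> lim T, which maps
spanning standard monomials to a basis, is bijective. The straightening relation
is at the same time the unique expansion of x y, which gives (ASL2). The grading
is direct because the exponent of the minimum in Hibi's embedding is the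
degree. *)

(** * Finite posets and distributive lattices *)

Section FinitePosets.
Variables (d : Order.disp_t) (Q : finPOrderType d).
Implicit Types x y z w : Q.

(** The size of the principal down-set: a strictly monotone height, defined
without reference to chains. *)
Definition rank x := #|[set y | (y <= x)%O]|.

Lemma rank_lt x y : (x < y)%O -> (rank x < rank y)%N.
Proof.
move=> xy; apply: proper_card; apply/properP; split.
  by apply/subsetP => w; rewrite !inE => wx; apply: le_trans wx (ltW xy).
by exists y; rewrite !inE ?lexx // lt_geF.
Qed.

Lemma exists_minimal (S : pred Q) x : S x ->
  exists2 y, S y & forall w, S w -> (w <= y)%O -> w = y.
Proof.
move=> Sx; case: (arg_minnP rank Sx) => y Sy ymin; exists y => // w Sw wy.
apply/eqP; move: wy; rewrite le_eqVlt => /orP[//|/rank_lt].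
by rewrite ltnNge ymin.
Qed.

Lemma chain_greatest (S : pred Q) x : S x ->
  (forall u v, S u -> S v -> (u >=< v)%O) ->
  exists2 y, S y & forall w, S w -> (w <= y)%O.
Proof.
move=> Sx chainS; case: (arg_maxnP rank Sx) => y Sy ymax; exists y => // w Sw.
case/orP: (chainS _ _ Sw Sy) => //; rewrite le_eqVlt => /orP[/eqP->//|/rank_lt yw].
by have := ymax w Sw; rewrite /= leqNgt yw.
Qed.

(** The condition mentions two-element joins only, so that the minimum of a
lattice is join prime. *)
Definition join_prime (j : Q) : Prop :=
  forall x y l, is_lub x y l -> (j <= l)%O -> (j <= x)%O \/ (j <= y)%O.

Hypothesis distrQ : is_distributive_lattice Q.

Lemma distributive_glb_exists x y : exists m, is_glb x y m.
Proof.
have [d' [L [f [[g fK gK] fM]]]] := distrQ.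
exists (g (f x `&` f y)%O).
split=> [||w wx wy]; rewrite -fM gK ?leIl ?leIr // lexI !fM.
by rewrite wx wy.
Qed.

Lemma distributive_lub_exists x y : exists j, is_lub x y j.
Proof.
have [d' [L [f [[g fK gK] fM]]]] := distrQ.
exists (g (f x `|` f y)%O).
split=> [||w xw yw]; rewrite -fM gK ?leUl ?leUr // leUx !fM.
by rewrite xw yw.
Qed.

(** A minimal j with j <= x and not j <= y is join prime: if j <= a \/ b, then
j = (j /\ a) \/ (j /\ b) by distributivity; if j lies below neither a nor b, both
terms are smaller than j, hence below y by minimality, and so is j. *)
Lemma join_prime_separation x y : ~~ (x <= y)%O ->
  exists j, [/\ join_prime j, (j <= x)%O & ~~ (j <= y)%O].
Proof.
move=> nxy; pose S j := (j <= x)%O && ~~ (j <= y)%O.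
have /exists_minimal[j /andP[jx njy] jmin] : S x by rewrite /S lexx.
exists j; split=> // a b l [al bl lmin] jl.
have [d' [L [f [[g fK gK] fM]]]] := distrQ.
have flE : f l = (f a `|` f b)%O.
  apply/le_anti; rewrite leUx !fM al bl !andbT.
  have : (l <= g (f a `|` f b))%O by apply: lmin; rewrite -fM gK ?leUl ?leUr.
  by rewrite -fM gK.
have below c : ~~ (j <= c)%O -> (f j `&` f c <= f y)%O.
  move=> njc; apply: contraR njc => ncy.
  have cj : (g (f j `&` f c) <= j)%O by rewrite -fM gK leIl.
  rewrite -(jmin (g (f j `&` f c))%O) -?fM ?gK ?leIl ?leIr //.
  by rewrite /S -!fM gK ncy andbT leIxl // fM.
have [ja|nja] := boolP (j <= a)%O; first by left.
have [jb|njb] := boolP (j <= b)%O; first by right.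
case/negP: njy; rewrite -fM -[f j](meet_l (y := f l)) ?fM //.
by rewrite flE meetUr leUx !below.
Qed.

End FinitePosets.

(** * Monomials and their linear combinations *)

Section Exponents.
Variables (d : Order.disp_t) (P : finPOrderType d).
Implicit Types m : {ffun P -> nat}.

Definition add_exp m m' : {ffun P -> nat} := [ffun x => (m x + m' x)%N].
Definition unit_exp (y : P) : {ffun P -> nat} := [ffun x => (x == y) : nat].

Lemma standardP m :
  reflect (forall x y, m x != 0%N -> m y != 0%N -> (x >=< y)%O) (standard m).
Proof.
apply: (iffP forallP) => [h x y mx my|h x].
  by have /forallP/(_ y) := h x; rewrite mx my.
by apply/forallP => y; apply/implyP => /andP[]; apply: h.
Qed.

End Exponents.

Arguments unit_exp {d P} y.

Section Monomials.
Variables (K : fieldType) (d : Order.disp_t) (P : finPOrderType d).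
Implicit Types (m : {ffun P -> nat}) (r : {fsfun {ffun P -> nat} -> K with 0}).

Section Target.
Variables (A : comAlgType K) (phi : P -> A).

Lemma phi_mon_add m m' : phi_mon phi (add_exp m m') = phi_mon phi m * phi_mon phi m'.
Proof. by rewrite /phi_mon -big_split; apply: eq_bigr => x _; rewrite ffunE exprD. Qed.

Lemma phi_mon_unit x : phi_mon phi (unit_exp x) = phi x.
Proof.
rewrite /phi_mon (bigD1 x) //= big1 ?mulr1 => [|y /negPf yx].
  by rewrite ffunE eqxx.
by rewrite ffunE yx.
Qed.

Lemma phi_mon0 : phi_mon phi [ffun=> 0%N] = 1.
Proof. by apply: big1 => x _; rewrite ffunE. Qed.

Lemma mon_combE r (S : {fset {ffun P -> nat}}) : (finsupp r `<=` S)%fset ->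
  mon_comb phi r = \sum_(m <- S) r m *: phi_mon phi m.
Proof.
move=> rS; apply: (big_fset_incl _ rS) => m _ /fsfun_dflt ->.
by rewrite scale0r.
Qed.

Lemma mon_comb0 : mon_comb phi [fsfun] = 0.
Proof. by rewrite (mon_combE (S := fset0)) ?big_seq_fset0 ?finsupp0 ?fsubset_refl. Qed.

(** The span of the monomials satisfying B, with B also bounding the
coefficients: applied with B stronger than standardness it locates the
monomials of an expansion, as (ASL2) requires. *)
Definition mon_span (B : {ffun P -> nat} -> Prop) (a : A) : Prop :=
  exists2 r : {fsfun {ffun P -> nat} -> K with 0},
    (forall m, r m != 0 -> B m) & a = mon_comb phi r.

Variable B : {ffun P -> nat} -> Prop.

Lemma mon_span0 : mon_span B 0.
Proof.
by exists [fsfun] => [m|]; rewrite ?mon_comb0 // fsfunE eqxx.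
Qed.

Lemma mon_span_lin a u v :
  mon_span B u -> mon_span B v -> mon_span B (a *: u + v).
Proof.
move=> [r hr ->] [s hs ->].
pose S := (finsupp r `|` finsupp s)%fset.
pose t : {fsfun {ffun P -> nat} -> K with 0} := [fsfun m in S => a * r m + s m].
have tE m : t m = a * r m + s m.
  rewrite fsfunE; case: ifPn => //; rewrite in_fsetU negb_or => /andP[mr ms].
  by rewrite !fsfun_dflt // mulr0 addr0.
exists t => [m|].
  rewrite tE; have [->|/hr//] := eqVneq (r m) 0.
  by rewrite mulr0 add0r => /hs.
rewrite (mon_combE (fsubsetUl _ (finsupp s))) (mon_combE (fsubsetUr (finsupp r) _)).
rewrite (mon_combE (r := t) (S := S)).
  rewrite scaler_sumr -big_split; apply: eq_bigr => m _.
  by rewrite tE scalerDl scalerA.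
apply/fsubsetP => m; rewrite mem_finsupp fsfunE.
by case: ifP => // _; rewrite eqxx.
Qed.

Lemma mon_span_mon m : B m -> mon_span B (phi_mon phi m).
Proof.
move=> Bm.
pose r : {fsfun {ffun P -> nat} -> K with 0} := [fsfun n in [fset m]%fset => 1].
exists r => [n|].
  by rewrite fsfunE inE; have [-> //|_] := eqVneq n m; rewrite eqxx.
rewrite (mon_combE (S := [fset m]%fset)).
  by rewrite big_seq_fset1 fsfunE inE eqxx scale1r.
by apply/fsubsetP => n; rewrite mem_finsupp fsfunE; case: ifP; rewrite ?eqxx.
Qed.

Lemma mon_spanD u v : mon_span B u -> mon_span B v -> mon_span B (u + v).
Proof. by move=> hu hv; rewrite -[u]scale1r; apply: mon_span_lin. Qed.

Lemma mon_spanZ a u : mon_span B u -> mon_span B (a *: u).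
Proof.
by move=> hu; rewrite -[_ *: _]addr0; apply: mon_span_lin => //; apply: mon_span0.
Qed.

Lemma mon_span_sum (I : eqType) (s : seq I) (Pr : pred I) (F : I -> A) :
  (forall i, i \in s -> Pr i -> mon_span B (F i)) ->
  mon_span B (\sum_(i <- s | Pr i) F i).
Proof.
move=> hF; rewrite big_seq_cond.
apply: (big_ind (mon_span B)); [exact: mon_span0 | exact: mon_spanD |].
by move=> i /andP[]; apply: hF.
Qed.

End Target.

Lemma phi_mon_morph (A A' : comAlgType K) (phi : P -> A) (f : {lrmorphism A -> A'}) m :
  f (phi_mon phi m) = phi_mon (f \o phi) m.
Proof. by rewrite rmorph_prod; apply: eq_bigr => x _; rewrite rmorphXn. Qed.

Lemma mon_comb_morph (A A' : comAlgType K) (phi : P -> A) (f : {lrmorphism A -> A'}) r :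
  f (mon_comb phi r) = mon_comb (f \o phi) r.
Proof.
by rewrite linear_sum; apply: eq_bigr => m _; rewrite linearZ /= -phi_mon_morph.
Qed.

Lemma eq_phi_mon (A : comAlgType K) (phi psi : P -> A) m :
  phi =1 psi -> phi_mon phi m = phi_mon psi m.
Proof. by move=> e; apply: eq_bigr => x _; rewrite e. Qed.

Lemma eq_mon_comb (A : comAlgType K) (phi psi : P -> A) r :
  phi =1 psi -> mon_comb phi r = mon_comb psi r.
Proof. by move=> e; apply: eq_bigr => x _; rewrite (eq_phi_mon _ e). Qed.

Definition mnm_of m : 'X_{1..#|P|} := [multinom m (enum_val i) | i < #|P|].

Lemma mnm_ofE m x : mnm_of m (enum_rank x) = m x.
Proof. by rewrite mnmE enum_rankK. Qed.

Lemma mnm_of_inj : injective mnm_of.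
Proof. by move=> m m' e; apply/ffunP => x; rewrite -!mnm_ofE e. Qed.

Lemma mnm_of_surj (n : 'X_{1..#|P|}) : exists m, n = mnm_of m.
Proof.
exists [ffun x => n (enum_rank x)]; apply/mnmP => i.
by rewrite mnmE ffunE enum_valK.
Qed.

Lemma phi_mon_var m : phi_mon (@var K P) m = 'X_[mnm_of m].
Proof.
rewrite mpolyXE_id (reindex_onto enum_rank enum_val) => [|i _]; last exact: enum_valK.
rewrite /phi_mon; apply: eq_big => [x|x _]; first by rewrite enum_rankK eqxx.
by rewrite mnm_ofE.
Qed.

Lemma mdeg_mnm_of m : mdeg (mnm_of m) = (\sum_x m x)%N.
Proof.
rewrite mdegE (reindex_onto enum_rank enum_val) => [|i _]; last exact: enum_valK.
by apply: eq_big => [x|x _]; rewrite ?enum_rankK ?eqxx // mnm_ofE.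
Qed.

(** Monomials in monomials are monomials: the exponents multiply as matrices. *)
Lemma phi_mon_comp (A : comAlgType K) (Q : finPOrderType d) (phi : Q -> A)
    (u : P -> {ffun Q -> nat}) m :
  phi_mon (fun x => phi_mon phi (u x)) m =
  phi_mon phi [ffun j => (\sum_x u x j * m x)%N].
Proof.
rewrite /phi_mon.
under eq_bigr => x _ do rewrite -prodrXl.
rewrite exchange_big; apply: eq_bigr => j _ /=.
rewrite ffunE expr_sum; apply: eq_bigr => x _.
by rewrite exprM.
Qed.

(** This reduces spanning, a statement about all polynomials, to the variables. *)
Lemma subalg_morph (A : comAlgType K) (f : {lrmorphism polyring K P -> A})
    (S : A -> Prop) :
  S 0 -> (forall a u v, S u -> S v -> S (a *: u + v)) ->
  S 1 -> (forall u v, S u -> S v -> S (u * v)) ->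
  (forall x, S (f (var K x))) -> forall p, S (f p).
Proof.
move=> S0 Slin S1 SM Sv p; rewrite [p]mpolyE linear_sum.
elim/big_rec: _ => // n a _ Sa; rewrite linearZ /=; apply: Slin => //.
have [m ->] := mnm_of_surj n.
rewrite -phi_mon_var.
suff : S (phi_mon (f \o @var K P) m) by rewrite -phi_mon_morph.
rewrite /phi_mon; elim/big_ind: _ => // x _.
elim: (m x) => [|k IH]; first by rewrite expr0.
by rewrite exprS; apply: SM IH; apply: Sv.
Qed.

End Monomials.

(** * Straightening *)

Section Straightening.
Variables (K : fieldType) (d : Order.disp_t) (P : finBPOrderType d).
Hypothesis hP : locally_distributive P.
Implicit Types x y z w : P.

Lemma bounded_glb_exists x y z : upper_bound x y z -> exists m, is_glb x y m.
Proof.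
move=> /andP[xz yz].
pose x' : lower_interval z := exist _ x xz.
pose y' : lower_interval z := exist _ y yz.
have [m [mx my mmax]] := distributive_glb_exists (hP z) x' y'.
exists (val m); split=> // w wx wy.
exact: (mmax (exist _ w (le_trans wx xz) : lower_interval z)).
Qed.

Section Target.
Variables (A : comAlgType K) (phi : P -> A).
Hypothesis phi_IT : forall g : polyring K P, IT_gens g -> poly_eval phi g = 0.

(** One shape for both kinds of generators: without an upper bound the sum is
empty and m = x serves. The bound m <= x makes m z a standard monomial. *)
Lemma straightening_relation x y : exists2 m, (m <= x)%O &
  phi x * phi y = \sum_(z in min_upper_bounds x y) phi m * phi z.
Proof.
have [/forallP noub|] := boolP [forall z, ~~ upper_bound x y z].
  exists x => //; rewrite big_pred0 => [|z].
    have := phi_IT (g := var K x * var K y).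
    rewrite rmorphM /= !poly_eval_var; apply; exists x, y; right.
    by split=> // z; apply: noub.
  by rewrite inE; apply/negbTE; rewrite negb_and noub.
rewrite negb_forall => /existsP[z0]; rewrite negbK => ub.
have [m mglb] := bounded_glb_exists ub; exists m; first by case: mglb.
apply/eqP; rewrite -mulr_sumr -subr_eq0.
have := phi_IT (g := var K x * var K y
  - var K m * \sum_(z in min_upper_bounds x y) var K z).
rewrite rmorphB !rmorphM rmorph_sum /= !poly_eval_var.
rewrite (eq_bigr phi) => [|z _]; last exact: poly_eval_var.
move=> -> //; exists x, y; left; exists m => //; split=> //.
by exists z0.
Qed.

(** The measure that straightening increases: rank z > rank x, rank y gives
2 ^ rank x + 2 ^ rank y <= 2 ^ rank z. *)
Definition weight (m : {ffun P -> nat}) := (\sum_x m x * 2 ^ rank x)%N.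

Lemma sum_add_exp (F : P -> nat) (m n : {ffun P -> nat}) :
  (\sum_x add_exp m n x * F x = \sum_x m x * F x + \sum_x n x * F x)%N.
Proof. by rewrite -big_split; apply: eq_bigr => x _; rewrite ffunE mulnDl. Qed.

Lemma sum_unit_exp (F : P -> nat) x : (\sum_w unit_exp x w * F w = F x)%N.
Proof.
rewrite (bigD1 x) //= big1 ?addn0 => [|y /negPf yx].
  by rewrite ffunE eqxx mul1n.
by rewrite ffunE yx.
Qed.

(** Descending induction on the weight, which is at most degree * 2 ^ #|P|. *)
Lemma phi_mon_straighten m : mon_span phi (@standard _ P) (phi_mon phi m).
Proof.
pose deg (n : {ffun P -> nat}) := (\sum_x n x * 1)%N.
have [N] := ubnP (deg m * 2 ^ #|P| - weight m)%N.
elim: N m => // N IH m ltN.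
have [sm|nsm] := boolP (standard m); first exact: mon_span_mon.
have [x [y [mx my xy]]] : exists x y, [/\ m x != 0%N, m y != 0%N & ~~ (x >=< y)%O].
  move: nsm; rewrite negb_forall => /existsP[x]; rewrite negb_forall => /existsP[y].
  by rewrite negb_imply => /andP[/andP[mx my] xy]; exists x, y.
pose n := [ffun w => (m w - (w == x) - (w == y))%N].
have xneqy : (y == x) = false.
  by apply/negbTE; apply: contra xy => /eqP ->; rewrite comparablexx.
(* The factorization m = n x y exhibits one product to be straightened. *)
have mE : m = add_exp n (add_exp (unit_exp x) (unit_exp y)).
  apply/ffunP => w; rewrite !ffunE.
  have [->|_] := eqVneq w x; first by rewrite eq_sym xneqy subn0 addn0 subnK // lt0n.
  have [->|_] := eqVneq w y; first by rewrite subn0 add0n subnK // lt0n.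
  by rewrite !subn0 addn0.
have [w wx rel] := straightening_relation x y.
rewrite mE !phi_mon_add !phi_mon_unit rel mulr_sumr.
apply: mon_span_sum => z _; rewrite inE => /andP[/andP[xz yz] _].
have xz' : (x < z)%O.
  rewrite lt_neqAle xz andbT; apply: contra xy => /eqP ->.
  by rewrite comparable_sym le_comparable.
have yz' : (y < z)%O.
  by rewrite lt_neqAle yz andbT; apply: contra xy => /eqP ->; rewrite le_comparable.
rewrite -!phi_mon_unit -!phi_mon_add; apply: IH.
have degE : deg (add_exp n (add_exp (unit_exp w) (unit_exp z))) = deg m.
  by rewrite mE /deg !sum_add_exp !sum_unit_exp.
have weight_lt : (weight m < weight (add_exp n (add_exp (unit_exp w) (unit_exp z))))%N.
  rewrite mE /weight !sum_add_exp !sum_unit_exp ltn_add2l.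
  (* The inequality is strict because the meet contributes 2 ^ rank w > 0. *)
  apply: (@leq_ltn_trans (2 ^ rank z)); last by rewrite -add1n leq_add2r expn_gt0.
  have [k] : exists k, rank z = k.+1.
    by exists (rank z).-1; rewrite prednK // (leq_ltn_trans _ (rank_lt xz')).
  move=> zk; rewrite zk expnS mul2n -addnn leq_add // leq_exp2l //.
    by rewrite -ltnS -zk rank_lt.
  by rewrite -ltnS -zk rank_lt.
have weight_max u : (weight u <= deg u * 2 ^ #|P|)%N.
  rewrite /deg big_distrl leq_sum //= => v _.
  by rewrite muln1 leq_mul2l leq_exp2l // max_card orbT.
rewrite degE; apply: leq_trans (_ : _ < deg m * 2 ^ #|P| - weight m)%N _ => //.
by apply: ltn_sub2l => //; apply: leq_trans weight_lt _; rewrite -degE.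
Qed.

Lemma mon_span_standardM u v :
  mon_span phi (@standard _ P) u -> mon_span phi (@standard _ P) v ->
  mon_span phi (@standard _ P) (u * v).
Proof.
move=> [r _ ->] [s _ ->]; rewrite mulr_suml; apply: mon_span_sum => m _ _.
rewrite mulr_sumr; apply: mon_span_sum => n _ _.
rewrite -scalerAl -scalerAr -phi_mon_add.
by do 2!apply: mon_spanZ; apply: phi_mon_straighten.
Qed.

Lemma mon_span_standard_morph d' (Q : finPOrderType d')
    (f : {lrmorphism polyring K Q -> A}) :
  (forall x : Q, mon_span phi (@standard _ P) (f (var K x))) ->
  forall p, mon_span phi (@standard _ P) (f p).
Proof.
move=> fv; apply: subalg_morph => //; first exact: mon_span0.
- by move=> a u v; apply: mon_span_lin.
- rewrite -(phi_mon0 phi); exact: phi_mon_straighten.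
- exact: mon_span_standardM.
Qed.

Lemma mon_span_standard_gen x : mon_span phi (@standard _ P) (phi x).
Proof. by rewrite -phi_mon_unit; apply: phi_mon_straighten. Qed.

End Target.
End Straightening.

(** * The embedding into a polynomial ring on the join primes *)

Section PrimeMonomials.
Variables (K : fieldType) (d : Order.disp_t) (Q : finPOrderType d).
Implicit Types x y j : Q.

Definition prime_exp x : {ffun Q -> nat} :=
  [ffun j => `[< join_prime j >] && (j <= x)%O : nat].

Definition prime_mon x : polyring K Q := phi_mon (@var K Q) (prime_exp x).

Definition total_prime_exp (m : {ffun Q -> nat}) : {ffun Q -> nat} :=
  [ffun j => (\sum_x prime_exp x j * m x)%N].

Lemma phi_mon_prime_mon m :
  phi_mon prime_mon m = 'X_[mnm_of (total_prime_exp m)].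
Proof. by rewrite phi_mon_comp phi_mon_var. Qed.

(** A join prime lies below x /\ y when below both, and below x \/ y when below
at least one of x, y: its indicator is a modular function. *)
Lemma prime_exp_modular x y m l : is_glb x y m -> is_lub x y l ->
  add_exp (prime_exp x) (prime_exp y) = add_exp (prime_exp m) (prime_exp l).
Proof.
move=> [mx my mM] lubl; have [xl yl _] := lubl.
apply/ffunP => j; rewrite !ffunE; case: asboolP => //= primej.
have -> : (j <= m)%O = (j <= x)%O && (j <= y)%O.
  by apply/idP/andP => [jm|[]]; [split; apply: le_trans jm _ | apply: mM].
have -> : (j <= l)%O = (j <= x)%O || (j <= y)%O.
  apply/idP/orP => [/(primej _ _ _ lubl)//|[jx|jy]].
    exact: le_trans xl.
  exact: le_trans yl.
by case: (j <= x)%O; case: (j <= y)%O.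
Qed.

Lemma prime_mon_relation x y m l : is_glb x y m -> is_lub x y l ->
  prime_mon x * prime_mon y = prime_mon m * prime_mon l.
Proof. by move=> glbm lubl; rewrite -!phi_mon_add (prime_exp_modular glbm lubl). Qed.

Hypothesis distrQ : is_distributive_lattice Q.
Variable bot : Q.
Hypothesis bot_le : forall x, (bot <= x)%O.

Lemma join_prime_bot : join_prime bot.
Proof. by move=> x y l _ _; left. Qed.

(** A single join prime below x cuts out of a chain its part above x: take one
that separates x from the largest element y of the chain not above x; the
elements not above x are then below y. If all elements are above x, the minimum
will do. *)
Lemma chain_cut m x : standard m ->
  exists j, [/\ join_prime j, (j <= x)%O
    & forall w, m w != 0%N -> (j <= w)%O -> (x <= w)%O].
Proof.
move=> /standardP sm.
have [/existsP[w0 S0]|noS] := boolP [exists w, (m w != 0%N) && ~~ (x <= w)%O].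
  pose S w := (m w != 0%N) && ~~ (x <= w)%O.
  have [|y /andP[my nxy] ymax] := @chain_greatest _ _ S w0 S0.
    by move=> u v /andP[mu _] /andP[mv _]; apply: sm.
  have [j [primej jx njy]] := join_prime_separation distrQ nxy.
  exists j; split=> // w mw jw; apply: contraR njy => nxw.
  by apply: le_trans jw (ymax _ _); rewrite /S mw.
exists bot; split=> // [|w mw _]; first exact: join_prime_bot.
move: noS; rewrite negb_exists => /forallP/(_ w).
by rewrite mw negbK.
Qed.

Definition upper_sum (m : {ffun Q -> nat}) x := (\sum_(y | (x <= y)%O) m y)%N.

Lemma total_prime_expE m j : join_prime j -> total_prime_exp m j = upper_sum m j.
Proof.
move=> primej; rewrite ffunE /upper_sum [RHS]big_mkcond; apply: eq_bigr => y _.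
by rewrite ffunE; case: asboolP => //= _; case: ifP; rewrite ?mul1n ?mul0n.
Qed.

(** Although x need not be join prime, its upper sum is the exponent at the join
prime of [chain_cut], and that exponent bounds the upper sum at x from above for
any other monomial. *)
Lemma upper_sum_le (m m' : {ffun Q -> nat}) x : standard m ->
  total_prime_exp m = total_prime_exp m' -> (upper_sum m' x <= upper_sum m x)%N.
Proof.
move=> sm e; have [j [primej jx cut]] := chain_cut x sm.
have -> : upper_sum m x = upper_sum m j.
  rewrite /upper_sum [LHS]big_mkcond [RHS]big_mkcond; apply: eq_bigr => w _.
  case: ifPn => [xw|nxw]; first by rewrite (le_trans jx xw).
  case: ifP => // jw; have [//|mw] := eqVneq (m w) 0%N.
  by rewrite (cut w mw jw) in nxw.
rewrite -(total_prime_expE _ primej) e total_prime_expE // /upper_sum.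
rewrite big_mkcond [leqRHS]big_mkcond; apply: leq_sum => w _.
by case: ifP => // xw; rewrite (le_trans jx xw).
Qed.

(** By symmetry of [upper_sum_le] the upper sums agree everywhere, and they
determine the exponents from the top of the poset downwards. *)
Lemma total_prime_exp_inj m m' : standard m -> standard m' ->
  total_prime_exp m = total_prime_exp m' -> m = m'.
Proof.
move=> sm sm' e.
have same x : upper_sum m x = upper_sum m' x.
  by apply/eqP; rewrite eqn_leq !upper_sum_le.
apply/ffunP => x0; apply/eqP; apply: contraT => ne0.
case: (arg_maxnP (P := fun x => m x != m' x) (@rank _ Q) ne0) => x ne xmax.
case/negP: ne; have := same x.
rewrite /upper_sum !(bigD1 (P := fun y => (x <= y)%O) x) //=.
suff -> : (\sum_(y | (x <= y)%O && (y != x)) m y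
         = \sum_(y | (x <= y)%O && (y != x)) m' y)%N.
  by move/eqP; rewrite eqn_add2r.
apply: eq_bigr => y /andP[xy yx]; apply/eqP; apply: contraT => /xmax /=.
have : (x < y)%O by rewrite lt_neqAle eq_sym yx.
by move/rank_lt; rewrite ltnNge => /negbTE ->.
Qed.

Lemma upper_sum_bot m : upper_sum m bot = (\sum_x m x)%N.
Proof. by apply: eq_bigl => x; rewrite bot_le. Qed.

End PrimeMonomials.

Section PrimeEmbedding.
Variables (K : fieldType) (d : Order.disp_t) (P : finBPOrderType d) (z : P).
Hypothesis hP : locally_distributive P.

Lemma prime_mon_T_gens g : T_ideal K z g ->
  poly_eval (@prime_mon K _ (lower_interval z)) g = 0.
Proof.
move=> [x [y [m [j [glbm lubj ->]]]]].
rewrite rmorphB !rmorphM /= !poly_eval_var.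
by rewrite (prime_mon_relation _ glbm lubj) subrr.
Qed.

(** Hibi's realization of T_z as the toric ring of the lattice [0,z]. *)
Definition prime_embedding : {lrmorphism T_at K z -> polyring K (lower_interval z)} :=
  quot_lift prime_mon_T_gens.

Lemma prime_embedding_pi p : prime_embedding (quot_pi (T_ideal K z) p) =
  poly_eval (@prime_mon K _ (lower_interval z)) p.
Proof. exact: quot_liftE. Qed.

Definition supp_le (m : {ffun P -> nat}) : bool :=
  [forall x, (m x != 0%N) ==> (x <= z)%O].

Definition restr_exp (m : {ffun P -> nat}) : {ffun lower_interval z -> nat} :=
  [ffun x => m (val x)].

Lemma restr_exp_inj m m' : supp_le m -> supp_le m' ->
  restr_exp m = restr_exp m' -> m = m'.
Proof.
move=> /forallP mz /forallP m'z e; apply/ffunP => x.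
have [xz|nxz] := boolP (x <= z)%O.
  by have /ffunP/(_ (exist _ x xz : lower_interval z)) := e; rewrite !ffunE.
have := mz x; have := m'z x; rewrite (negbTE nxz) !implybF !negbK.
by move=> /eqP -> /eqP ->.
Qed.

Lemma standard_restr_exp m : standard m -> standard (restr_exp m).
Proof.
move=> /standardP sm; apply/standardP => x y; rewrite !ffunE => mx my.
exact: sm.
Qed.

Lemma phi_mon_T_class_out m : ~~ supp_le m -> phi_mon (T_class K z) m = 0.
Proof.
rewrite negb_forall => /existsP[x]; rewrite negb_imply => /andP[mx nxz].
by rewrite /phi_mon (bigD1 x) //= T_class_out // expr0n (negbTE mx) mul0r.
Qed.

Lemma phi_mon_T_class_in m : supp_le m -> phi_mon (T_class K z) m =
  phi_mon (fun x : lower_interval z => quot_pi (T_ideal K z) (var K x)) (restr_exp m).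
Proof.
move=> /forallP mz; rewrite /phi_mon.
rewrite (bigID (fun x => x <= z)%O) /= [X in _ * X]big1 ?mulr1 => [|x nxz].
  pose z' : lower_interval z := exist _ z (lexx z).
  rewrite (reindex_onto val (insubd z')) => [|x xz]; last by rewrite insubdK.
  apply: eq_big => [x|x _]; first by rewrite (valP x) valKd eqxx.
  by rewrite ffunE T_class_in.
by have := mz x; rewrite (negbTE nxz) implybF negbK => /eqP ->.
Qed.

Lemma prime_embedding_mon m : supp_le m ->
  phi_mon (prime_embedding \o T_class K z) m =
  'X_[mnm_of (total_prime_exp (restr_exp m))].
Proof.
move=> mz; rewrite -phi_mon_morph phi_mon_T_class_in // phi_mon_morph.
rewrite -(phi_mon_prime_mon K); apply: eq_phi_mon => x.
by rewrite -[LHS]/(prime_embedding (quot_pi _ _)) prime_embedding_pi poly_eval_var.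
Qed.

Definition interval_bot : lower_interval z := exist _ \bot%O (le0x z).

Lemma interval_bot_le (x : lower_interval z) : (interval_bot <= x)%O.
Proof. exact: le0x. Qed.

(** The coefficient functional that recovers r m: it detects m alone, since
distinct standard monomials below z have distinct images and the others
vanish in T_z. *)
Lemma prime_embedding_coeff r m : standard_comb r -> supp_le m -> standard m ->
  (prime_embedding (mon_comb (T_class K z) r))@_
    (mnm_of (total_prime_exp (restr_exp m))) = r m.
Proof.
move=> sr mz sm; rewrite mon_comb_morph.
rewrite (@mon_combE _ _ _ _ _ r (m |` finsupp r)%fset) ?fsubsetU1 //.
rewrite (big_fsetD1 m) ?fset1U1 //= mcoeffD mcoeffZ prime_embedding_mon //.
rewrite mcoeffX eqxx mulr1 raddf_sum.
rewrite big_seq_cond big1 ?addr0 // => m'; rewrite !inE andbT => /andP[m'm _] /=.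
have [->|/sr sm'] := eqVneq (r m') 0; first by rewrite scale0r mcoeff0.
rewrite mcoeffZ; have [m'z|nm'z] := boolP (supp_le m'); last first.
  by rewrite -phi_mon_morph phi_mon_T_class_out // rmorph0 mcoeff0 mulr0.
rewrite prime_embedding_mon // mcoeffX; case: eqP; rewrite ?mulr0 // => /mnm_of_inj.
have [srm srm'] := (standard_restr_exp sm, standard_restr_exp sm').
move/(total_prime_exp_inj (hP z) interval_bot_le srm' srm).
by move/(restr_exp_inj m'z mz)/eqP; rewrite (negbTE m'm).
Qed.

Lemma T_class_comb_ext (r r' : {fsfun {ffun P -> nat} -> K with 0}) :
  (forall m, supp_le m -> r m = r' m) ->
  mon_comb (T_class K z) r = mon_comb (T_class K z) r'.
Proof.
move=> e; rewrite (mon_combE _ (fsubsetUl _ (finsupp r'))).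
rewrite (mon_combE _ (fsubsetUr (finsupp r) _)); apply: eq_bigr => m _.
have [/e -> //|nmz] := boolP (supp_le m).
by rewrite phi_mon_T_class_out // !scaler0.
Qed.

Lemma standard_T_class_coeff_unique (r r' : {fsfun {ffun P -> nat} -> K with 0}) :
  standard_comb r -> standard_comb r' ->
  mon_comb (T_class K z) r = mon_comb (T_class K z) r' ->
  forall m, supp_le m -> r m = r' m.
Proof.
move=> sr sr' e m mz; have [sm|nsm] := boolP (standard m).
  by rewrite -(prime_embedding_coeff sr mz sm) e prime_embedding_coeff.
have -> : r m = 0 by apply/eqP; apply: contraNT nsm; apply: sr.
by apply/esym/eqP; apply: contraNT nsm; apply: sr'.
Qed.

End PrimeEmbedding.

(** * The limit *)

Lemma poly_eval_unique (K : fieldType) (Q : finType) (A : comAlgType K)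
    (h : Q -> A) (f : {lrmorphism polyring K Q -> A}) :
  (forall x, f (var K x) = h x) -> f =1 poly_eval h.
Proof.
move=> fh p; rewrite [p]mpolyE !linear_sum; apply: eq_bigr => m _ /=.
rewrite !linearZ /=; congr (_ *: _).
rewrite mpolyXE_id !rmorph_prod; apply: eq_bigr => i _; rewrite !rmorphXn /=.
by congr (_ ^+ _); rewrite -[i]enum_valK poly_eval_var fh.
Qed.

Section LimitComponents.
Variables (K : fieldType) (d : Order.disp_t) (P : finBPOrderType d) (z : P).

(** The projection, retyped as a function to T_z so that it carries algebra
morphism instances. *)
Definition lim_at (s : lim (T_alg K P)) : T_at K z := lim_val s z.

Fact lim_at_zmod : zmod_morphism lim_at. Proof. by []. Qed.
Fact lim_at_monoid : monoid_morphism lim_at. Proof. by []. Qed.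
Fact lim_at_scalable : scalable lim_at. Proof. by []. Qed.

HB.instance Definition _ :=
  GRing.isZmodMorphism.Build (lim (T_alg K P)) (T_at K z) lim_at lim_at_zmod.
HB.instance Definition _ :=
  GRing.isMonoidMorphism.Build (lim (T_alg K P)) (T_at K z) lim_at lim_at_monoid.
HB.instance Definition _ :=
  GRing.isScalable.Build K (lim (T_alg K P)) (T_at K z) *:%R lim_at lim_at_scalable.

Lemma lim_at_T_elt x : lim_at (T_elt K x) = T_class K z x.
Proof. by []. Qed.

Lemma lim_at_mon_comb r : lim_at (mon_comb (@T_elt K d P) r) = mon_comb (T_class K z) r.
Proof. exact: mon_comb_morph. Qed.

Lemma lim_at_poly_eval p :
  lim_at (poly_eval (@T_elt K d P) p) = poly_eval (T_class K z) p.
Proof.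
by apply: (poly_eval_unique (f := lim_at \o poly_eval (@T_elt K d P))) => x /=;
   rewrite poly_eval_var. Qed.

End LimitComponents.

Section LimitStandardBasis.
Variables (K : fieldType) (d : Order.disp_t) (P : finBPOrderType d).
Hypothesis hP : locally_distributive P.
Implicit Types x y z w : P.

Lemma lim_ext (s t : lim (T_alg K P)) : (forall z, lim_at z s = lim_at z t) -> s = t.
Proof. by move=> e; apply/val_inj/prodalgP. Qed.

(** The join of x and y in [0,z] is a minimal upper bound of x and y in P, and the
only one below z; all others are zero in T_z. *)
Lemma sum_min_upper_bounds_T_class z x y (x' y' j : lower_interval z) :
  val x' = x -> val y' = y -> is_lub x' y' j ->
  \sum_(w in min_upper_bounds x y) T_class K z w = T_class K z (val j).
Proof.
move=> <- <- [xj yj jmin].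
have ubj : upper_bound (val x') (val y') (val j) by apply/andP.
have below w : upper_bound (val x') (val y') w -> (w <= z)%O -> (val j <= w)%O.
  by move=> /andP[xw yw] wz; apply: (jmin (exist _ w wz : lower_interval z)).
rewrite (bigD1 (val j)) /=; last first.
  rewrite inE; apply/andP; split=> //.
  apply/forallP => w; apply/implyP => /andP[ubw wj].
  by apply/eqP/le_anti; rewrite wj below // (le_trans wj (valP j)).
rewrite big1 ?addr0 // => w /andP[]; rewrite inE => /andP[ubw /forallP wmin] wj.
apply: T_class_out; apply: contra wj => /(below _ ubw) jw; rewrite eq_sym.
by have := wmin (val j); rewrite ubj jw.
Qed.

Lemma T_class_IT z (g : polyring K P) : IT_gens g -> poly_eval (T_class K z) g = 0.
Proof.
have out x y : ~~ upper_bound x y z -> T_class K z x * T_class K z y = 0.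
  by rewrite negb_and => /orP[] /T_class_out ->; rewrite ?mul0r ?mulr0.
move=> [x [y [[m [mx my mM] [_ ->]]|[noub ->]]]]; last first.
  by rewrite rmorphM /= !poly_eval_var out.
rewrite rmorphB !rmorphM rmorph_sum /= !poly_eval_var.
rewrite (eq_bigr (T_class K z)) => [|w _]; last exact: poly_eval_var.
have [/andP[xz yz]|nub] := boolP (upper_bound x y z); last first.
  rewrite out // big1 ?mulr0 ?subr0 // => w; rewrite inE => /andP[/andP[xw yw] _].
  apply: T_class_out; apply: contra nub => wz.
  by rewrite /upper_bound !(le_trans _ wz).
pose x' : lower_interval z := exist _ x xz.
pose y' : lower_interval z := exist _ y yz.
pose m' : lower_interval z := exist _ m (le_trans mx xz).
have [j lubj] := distributive_lub_exists (hP z) x' y'.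
rewrite (sum_min_upper_bounds_T_class (x' := x') (y' := y') _ _ lubj) //.
rewrite -[x]/(val x') -[y]/(val y') -[m]/(val m') !T_class_in -!rmorphM -rmorphB /=.
rewrite -(rmorph0 (quot_pi (T_ideal K z))); apply/quot_piP; rewrite subr0.
apply: ideal_gen_incl; exists x', y', m', j; split=> //; split=> // w wx wy.
exact: mM.
Qed.

(** This is the inclusion of I_T in the kernel of K[P] -> lim T, checked
componentwise. *)
Lemma T_elt_IT (g : polyring K P) : IT_gens g -> poly_eval (@T_elt K d P) g = 0.
Proof.
move=> gI; apply: lim_ext => z; rewrite lim_at_poly_eval T_class_IT //.
Qed.

Lemma T_at_span z (t : T_at K z) : mon_span (T_class K z) (@standard _ P) t.
Proof.
rewrite -[t]quot_reprK.
apply: (mon_span_standard_morph hP (@T_class_IT z)) => x.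
by have := mon_span_standard_gen hP (@T_class_IT z) (val x); rewrite T_class_in.
Qed.

Lemma prime_embedding_eq0 z (t : T_at K z) : prime_embedding K z t = 0 -> t = 0.
Proof.
have [r sr ->] := T_at_span t => e.
rewrite (@T_class_comb_ext _ _ _ _ r [fsfun]) ?mon_comb0 // => m mz.
rewrite fsfunE; have [sm|nsm] := boolP (standard m).
  by rewrite -(prime_embedding_coeff hP sr mz sm) e mcoeff0.
by apply/eqP; apply: contraNT nsm; apply: sr.
Qed.

(** The top of the empty chain is the minimum of P, so that the constant monomial
survives in every T_z. *)
Lemma standard_top (m : {ffun P -> nat}) : standard m ->
  exists t, supp_le t m /\ forall z, supp_le z m -> (t <= z)%O.
Proof.
move=> /standardP sm; have [/existsP[x mx]|] := boolP [exists x, m x != 0%N].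
  have [t mt tmax] := @chain_greatest _ _ (fun x => m x != 0%N) x mx sm.
  exists t; split=> [|z /forallP/(_ t)]; last by rewrite mt.
  by apply/forallP => w; apply/implyP/tmax.
rewrite negb_exists => /forallP m0; exists \bot%O; split=> [|z _]; last exact: le0x.
by apply/forallP => w; rewrite (negbTE (m0 w)).
Qed.

Lemma standard_coeff_unique (r r' : {fsfun {ffun P -> nat} -> K with 0}) :
  standard_comb r -> standard_comb r' ->
  mon_comb (@T_elt K d P) r = mon_comb (@T_elt K d P) r' -> forall m, r m = r' m.
Proof.
move=> sr sr' e m; have [sm|nsm] := boolP (standard m).
  have [t [mt _]] := standard_top sm.
  apply: (standard_T_class_coeff_unique hP sr sr') mt.
  by rewrite -!lim_at_mon_comb e.
have -> : r m = 0 by apply/eqP; apply: contraNT nsm; apply: sr.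
by apply/esym/eqP; apply: contraNT nsm; apply: sr'.
Qed.

(** Surjectivity onto the limit. The coefficient of m is read in T_t, where t is
the top of m; by compatibility any T_z in which m survives, that is t <= z, gives
the same value. *)
Lemma lim_span (s : lim (T_alg K P)) : mon_span (@T_elt K d P) (@standard _ P) s.
Proof.
have /choice[r_ hr] : forall z, exists r : {fsfun {ffun P -> nat} -> K with 0},
    standard_comb r /\ lim_at z s = mon_comb (T_class K z) r.
  by move=> z; have [r sr rE] := T_at_span (lim_at z s); exists r.
have /choice[top topP] : forall m : {ffun P -> nat}, exists t, standard m ->
    supp_le t m /\ forall z, supp_le z m -> (t <= z)%O.
  move=> m; have [sm|_] := boolP (standard m); last by exists \bot%O.
  by have [t ht] := standard_top sm; exists t.
pose S := [fset m in flatten [seq enum_fset (finsupp (r_ z)) | z <- enum P]]%fset.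
pose r : {fsfun {ffun P -> nat} -> K with 0} :=
  [fsfun m in S => if standard m then r_ (top m) m else 0].
have rE m : r m = if standard m then r_ (top m) m else 0.
  rewrite fsfunE; case: ifPn => // mS; case: ifP => // _; apply/esym/fsfun_dflt.
  apply: contra mS => mr; rewrite inE; apply/flatten_mapP.
  by exists (top m); rewrite ?mem_enum.
exists r => [m|]; first by rewrite rE; case: ifP; rewrite ?eqxx.
apply: lim_ext => z; rewrite lim_at_mon_comb (hr z).2; apply: T_class_comb_ext => m mz.
rewrite rE; case: ifPn => [sm|nsm]; last first.
  by apply/eqP; apply: contraNT nsm; apply: (hr z).1.
have [mt tmin] := topP m sm; have tz := tmin z mz.
apply: (standard_T_class_coeff_unique hP (hr z).1 (hr (top m)).1) mt.
have /asboolP/(_ _ _ tz) := valP s.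
rewrite -[val s _]/(lim_at z s) -[val s _]/(lim_at (top m) s) !(hr _).2 => <-.
rewrite -[RHS]/(T_restr K tz _) mon_comb_morph; apply: eq_mon_comb => x.
by rewrite -(T_restr_class K tz).
Qed.

End LimitStandardBasis.

(** * The algebra with straightening law *)

Section LimitASL.
Variables (K : fieldType) (d : Order.disp_t) (P : finBPOrderType d).
Hypothesis hP : locally_distributive P.
Implicit Types x y z w : P.

Lemma T_class_neq0 z : T_class K z z != 0.
Proof.
have zz : supp_le z (unit_exp z).
  by apply/forallP => w; rewrite ffunE;
    have [->|] := eqVneq w z; rewrite ?lexx ?implybT.
apply: contraTneq isT => z0; have := prime_embedding_mon K zz.
rewrite -phi_mon_morph phi_mon_unit z0 rmorph0.
set n := mnm_of _ => /(congr1 (mcoeff n))/eqP.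
by rewrite mcoeff0 mcoeffX eqxx eq_sym oner_eq0.
Qed.

Lemma T_elt_inj : injective (@T_elt K d P).
Proof.
have le x y : T_elt K x = T_elt K y -> (x <= y)%O.
  move=> e; apply: contraT => nxy; case/negP: (T_class_neq0 y).
  by rewrite -lim_at_T_elt -e lim_at_T_elt T_class_out.
by move=> x y e; apply: le_anti; rewrite !le.
Qed.

Lemma T_elt_ASL1 : ASL1 (@T_elt K d P).
Proof.
split; last exact: lim_span.
move=> r sr r0 m; rewrite (standard_coeff_unique hP sr (r' := [fsfun])) ?fsfunE //.
  by move=> n; rewrite fsfunE eqxx.
by rewrite mon_comb0.
Qed.

(** The straightening relation is an expansion into standard monomials whose
tops are the minimal upper bounds of x and y; by uniqueness it is the given
one. *)
Lemma T_elt_ASL2 : ASL2 (@T_elt K d P).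
Proof.
move=> x y xy r sr e m rm.
pose B (n : {ffun P -> nat}) := standard n /\ exists t : P,
  [/\ n t != 0%N, forall w, n w != 0%N -> (w <= t)%O, (x < t)%O & (y < t)%O].
have [r' Br' e'] : mon_span (@T_elt K d P) B (T_elt K x * T_elt K y).
  have [w wx ->] := straightening_relation hP (@T_elt_IT K _ _ hP) x y.
  apply: mon_span_sum => z _.
  rewrite inE => /andP[/andP[xz yz] _].
  rewrite -!phi_mon_unit -phi_mon_add; apply: mon_span_mon.
  have wz := le_trans wx xz.
  have supp v : add_exp (unit_exp w) (unit_exp z) v != 0%N -> v = w \/ v = z.
    rewrite !ffunE; have [-> _|_] := eqVneq v w; first by left.
    by have [-> _|_ //] := eqVneq v z; right.
  split.
    apply/standardP => u v /supp[] -> /supp[] ->.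
    - exact: comparablexx.
    - exact: le_comparable.
    - by rewrite comparable_sym le_comparable.
    - exact: comparablexx.
  exists z; split; first by rewrite !ffunE eqxx addn1.
  - by move=> v /supp[] ->.
  - rewrite lt_neqAle xz andbT; apply: contra xy => /eqP ->.
    by rewrite comparable_sym le_comparable.
  - by rewrite lt_neqAle yz andbT; apply: contra xy => /eqP ->; rewrite le_comparable.
have sr' : standard_comb r' by move=> n /Br'[].
rewrite (standard_coeff_unique hP sr sr') -?e -?e' // in rm.
by case: (Br' _ rm).
Qed.

End LimitASL.

(** * The grading *)

Section Homogeneous.
Variables (K : fieldType) (Q : finType).
Implicit Types p q : polyring K Q.

Lemma homogeneous0 i : homogeneous i (0 : polyring K Q).
Proof. by move=> m; rewrite msupp0. Qed.

Lemma homogeneousD i p q : homogeneous i p -> homogeneous i q -> homogeneous i (p + q).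
Proof. by move=> hp hq m /msuppD_le; rewrite mem_cat => /orP[/hp|/hq]. Qed.

Lemma homogeneousZ i (a : K) p : homogeneous i p -> homogeneous i (a *: p).
Proof. by move=> hp m /msuppZ_le/hp. Qed.

Lemma homogeneous1 : homogeneous 0 (1 : polyring K Q).
Proof. by move=> m; rewrite msupp1 inE => /eqP ->; rewrite mdeg0. Qed.

Lemma homogeneousM i j p q :
  homogeneous i p -> homogeneous j q -> homogeneous (i + j) (p * q).
Proof.
move=> hp hq m /msuppM_le/allpairsP[[u v] /= [up vq ->]].
by rewrite mdegD PoszD (hp _ up) (hq _ vq).
Qed.

Lemma homogeneous_var x : homogeneous 1 (var K x : polyring K Q).
Proof. by move=> m; rewrite msuppX inE => /eqP ->; rewrite mdeg1. Qed.

End Homogeneous.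

Section LimitGrading.
Variables (K : fieldType) (d : Order.disp_t) (P : finBPOrderType d).
Hypothesis hP : locally_distributive P.
Implicit Types (x y z : P) (i j : int) (s t : lim (T_alg K P)).

Lemma lim_gr0 i : lim_gr i (0 : lim (T_alg K P)).
Proof. by move=> z; exists 0; rewrite ?rmorph0 //; apply: homogeneous0. Qed.

Lemma lim_grD i s t : lim_gr i s -> lim_gr i t -> lim_gr i (s + t).
Proof.
move=> hs ht z; have [p hp pE] := hs z; have [q hq qE] := ht z.
exists (p + q); first exact: homogeneousD.
by rewrite [RHS]rmorphD /= -pE -qE.
Qed.

Lemma lim_grZ i (a : K) s : lim_gr i s -> lim_gr i (a *: s).
Proof.
move=> hs z; have [p hp pE] := hs z.
exists (a *: p); first exact: homogeneousZ.
by rewrite [RHS]linearZ /= -pE.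
Qed.

Lemma lim_gr1 : lim_gr 0 (1 : lim (T_alg K P)).
Proof. by move=> z; exists 1; rewrite ?rmorph1 //; apply: homogeneous1. Qed.

Lemma lim_grM i j s t : lim_gr i s -> lim_gr j t -> lim_gr (i + j) (s * t).
Proof.
move=> hs ht z; have [p hp pE] := hs z; have [q hq qE] := ht z.
exists (p * q); first exact: homogeneousM.
by rewrite [RHS]rmorphM /= -pE -qE.
Qed.

Lemma lim_gr_T_elt x : lim_gr 1 (T_elt K x).
Proof.
move=> z; rewrite /= /T_class; case: insub => [x'|].
  by exists (var K x') => //; apply: homogeneous_var.
by exists 0; rewrite ?rmorph0 //; apply: homogeneous0.
Qed.

Lemma lim_gr_phi_mon (m : {ffun P -> nat}) :
  lim_gr (Posz (\sum_x m x)%N) (phi_mon (@T_elt K d P) m).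
Proof.
rewrite /phi_mon.
apply: (big_ind2 (fun s n => lim_gr (Posz n) s)) => [|s n t k|x _].
- exact: lim_gr1.
- by rewrite PoszD; apply: lim_grM.
elim: (m x) => [|n IH]; first by rewrite expr0; apply: lim_gr1.
by rewrite exprS -add1n PoszD; apply: lim_grM IH; apply: lim_gr_T_elt.
Qed.

(** Standard monomials are homogeneous, so grouping the terms of a standard
expansion by degree decomposes s. *)
Lemma lim_gr_decomposition s : exists c : {fsfun int -> lim (T_alg K P) with 0},
  (forall i, lim_gr i (c i)) /\ s = \sum_(i <- finsupp c) c i.
Proof.
have [r _ ->] := lim_span hP s.
pose deg (m : {ffun P -> nat}) := Posz (\sum_x m x)%N.
pose F i := \sum_(m <- finsupp r | deg m == i) r m *: phi_mon (@T_elt K d P) m.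
pose S := [fset deg m | m in finsupp r]%fset.
pose c : {fsfun int -> lim (T_alg K P) with 0} := [fsfun i in S => F i].
have cE i : c i = F i.
  rewrite fsfunE; case: ifPn => // iS; rewrite /F big_seq_cond big_pred0 // => m.
  by apply/negbTE; apply: contra iS => /andP[mr /eqP <-]; apply: in_imfset.
exists c; split=> [i|].
  rewrite cE; apply: big_ind => [||m /eqP <-]; first exact: lim_gr0.
    exact: lim_grD.
  by apply: lim_grZ; apply: lim_gr_phi_mon.
have cS : (finsupp c `<=` S)%fset.
  by apply/fsubsetP => i; rewrite mem_finsupp fsfunE; case: ifP; rewrite ?eqxx.
rewrite (big_fset_incl _ cS) => [|i _ /fsfun_dflt //].
under [RHS]eq_bigr do rewrite cE.
rewrite (exchange_big_dep xpredT) //= /mon_comb; apply: eq_big_seq => m mr.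
have mS : deg m \in S by apply: in_imfset.
rewrite big_mkcond (big_fsetD1 _ mS) /= eqxx big_seq big1 ?addr0 // => i.
by rewrite !inE eq_sym => /andP[/negbTE ->].
Qed.

(** The minimum of [0,z] lies below every element, so its exponent in the image
of a monomial is the degree of that monomial. *)
Lemma prime_embedding_T_gr z i (t : T_at K z) n : T_gr i t ->
  (prime_embedding K z t)@_n != 0 -> Posz (n (enum_rank (interval_bot z))) = i.
Proof.
move=> [p hp ->]; rewrite prime_embedding_pi.
rewrite [p in poly_eval _ p]mpolyE rmorph_sum /= raddf_sum.
apply: contraNeq => ni; rewrite big_seq big1 // => k kp.
have [m kE] := mnm_of_surj k; rewrite linearZ /= mcoeffZ.
have -> : poly_eval (@prime_mon K _ (lower_interval z)) 'X_[k] =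
    'X_[mnm_of (total_prime_exp m)].
  rewrite kE -phi_mon_prime_mon -phi_mon_var.
  apply: etrans (phi_mon_morph _ (poly_eval (@prime_mon K _ (lower_interval z))) m) _.
  by apply: eq_phi_mon => x /=; rewrite poly_eval_var.
rewrite mcoeffX; case: eqP => [nE|_]; last by rewrite mulr0.
case/eqP: ni; rewrite -(hp _ kp) kE mdeg_mnm_of -nE mnm_ofE.
rewrite total_prime_expE ?upper_sum_bot //; first exact: interval_bot_le.
exact: join_prime_bot (@interval_bot_le _ _ z).
Qed.

(** Through the embedding, the component of degree i of any decomposition is the
part of the sum with exponent i at the minimum. *)
Lemma lim_gr_decomposition_unique (c c' : {fsfun int -> lim (T_alg K P) with 0}) :
  (forall i, lim_gr i (c i)) -> (forall i, lim_gr i (c' i)) ->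
  \sum_(i <- finsupp c) c i = \sum_(i <- finsupp c') c' i -> c = c'.
Proof.
pose h z n (t : lim (T_alg K P)) := (prime_embedding K z (lim_at z t))@_n.
have h0 z n : h z n 0 = 0 by rewrite /h !rmorph0 mcoeff0.
have hD z n : {morph h z n : s t / s + t} by move=> s t; rewrite /h !rmorphD mcoeffD.
have coeff (b : {fsfun int -> lim (T_alg K P) with 0}) z i n :
    (forall i, lim_gr i (b i)) -> h z n (b i) =
    if Posz (n (enum_rank (interval_bot z))) == i
    then h z n (\sum_(j <- finsupp b) b j) else 0.
  move=> hb; have vanish j : Posz (n (enum_rank (interval_bot z))) != j ->
      h z n (b j) = 0.
    by move=> nj; apply: contraNeq nj => /(prime_embedding_T_gr (hb j z)) ->.
  case: ifPn => [/eqP ni|/vanish //].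
  rewrite (big_morph _ (hD z n) (h0 z n)).
  have [iS|niS] := boolP (i \in finsupp b).
    rewrite (big_fsetD1 _ iS) /= [X in _ + X]big_seq big1 ?addr0 // => j.
    by rewrite !inE => /andP[ji _]; apply: vanish; rewrite ni eq_sym.
  rewrite fsfun_dflt // h0 big_seq big1 // => j jS.
  by apply: vanish; rewrite ni; apply: contraNneq niS => ->.
move=> hc hc' e; apply/fsfunP => i; apply: lim_ext => z; apply/eqP.
rewrite -subr_eq0; apply/eqP/(prime_embedding_eq0 hP)/mpolyP => n.
rewrite !rmorphB mcoeffB -/(h z n (c i)) -/(h z n (c' i)) !coeff //.
by rewrite e subrr mcoeff0.
Qed.

Lemma lim_Zgrading : is_Zgrading (@lim_gr K d P).
Proof.
split; [exact: lim_gr0|exact: lim_grD|exact: lim_grZ|exact: lim_gr1|exact: lim_grM|].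
move=> s; have [c [hc sE]] := lim_gr_decomposition s.
exists c; split=> [//|c' [hc' sE']].
by apply: lim_gr_decomposition_unique => //; rewrite -sE -sE'.
Qed.

End LimitGrading.

(** * The presentation of the limit *)

Theorem corollary4p3 (K : fieldType) (d : Order.disp_t) (P : finBPOrderType d)
    (hP : locally_distributive P) :
  is_graded_ASL_op (@T_elt K d P) (@lim_gr K d P) /\
  exists f : {lrmorphism quotalg (IT K P) -> lim (T_alg K P)},
    bijective f /\ forall p : polyring K P, f (quot_pi (IT K P) p) = T_nat p.
Proof.
split.
  split; first exact: lim_Zgrading.
    split; [exact: T_elt_inj|exact: T_elt_ASL1|exact: T_elt_ASL2].
  by move=> x; exists 1 => //; apply: lim_gr_T_elt.
have [f fE] : exists f : {lrmorphism quotalg (IT K P) -> lim (T_alg K P)},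
    forall p, f (quot_pi (IT K P) p) = T_nat p.
  exists (@quot_lift K _ (IT K P) _ (poly_eval (@T_elt K d P)) (@T_elt_IT K d P hP)).
  exact: quot_liftE.
exists f; split=> //.
pose v x := quot_pi (IT K P) (var K x).
have fv x : f (v x) = T_elt K x by rewrite fE; apply: poly_eval_var.
have v_IT (g : polyring K P) : IT_gens g -> poly_eval v g = 0.
  move=> gI; rewrite -(poly_eval_unique (f := quot_pi (IT K P))) //.
  rewrite -(rmorph0 (quot_pi (IT K P))); apply/quot_piP; rewrite subr0.
  exact: ideal_gen_incl.
have inj : injective f.
  suff f0 q : f q = 0 -> q = 0.
    move=> q q' e; apply/eqP; rewrite -subr_eq0; apply/eqP/f0.
    by rewrite rmorphB /= e subrr.
  have [r sr ->] : mon_span v (@standard _ P) q.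
    rewrite -[q]quot_reprK; apply: (mon_span_standard_morph hP v_IT) => x.
    exact: (mon_span_standard_gen hP v_IT).
  rewrite mon_comb_morph (eq_mon_comb r fv) => r0.
  have {}r0 := (T_elt_ASL1 K hP).1 r sr r0.
  by rewrite /mon_comb big1 // => m _; rewrite r0 scale0r.
(* Lift the standard expansion of each element of the limit. *)
have [g gK] : exists g, cancel g f.
  suff /choice[g gK] : forall s, exists q, f q = s by exists g.
  move=> s; have [r _ ->] := lim_span hP s; exists (mon_comb v r).
  by rewrite mon_comb_morph; apply: eq_mon_comb.
by exists g => // q; apply: inj; rewrite gK.
Qed.
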